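(* Let $0<p\le 1$ and let $G=(A,B,E)$ be a bipartite graph. Let $A'\subseteq A$ be an independent random sample with $\Pr[a\in A']=p$ for all $a\in A$, and let $F$ be the set of all pairs between $A'$ and $B$. Then for any ordering $\pi$ of the edges of $G$, $$\mathbb{E}_{A'}\,|\mathrm{Greedy}(F\cap\pi)|\ \ge\ \frac{p}{1+p}\,|\mathrm{opt}(G)|.$$
   Context: $\mathrm{Greedy}(\sigma)$ for a sequence $\sigma$ of edges: start with $M=\emptyset$ and, processing edges in order, add edge $e$ to $M$ whenever $M\cup\{e\}$ is still a matching; output $M$. $F\cap\pi$ is the subsequence of $\pi$ consisting of edges in $F$. $\mathrm{opt}(G)$ is a maximum matching of $G$. *)

(* Defs.v *)
From HB Require Import structures.
From mathcomp Require Import all_boot all_order all_algebra.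

Set Implicit Arguments.
Unset Strict Implicit.
Unset Printing Implicit Defensive.

Import Order.TTheory GRing.Theory Num.Theory.
Local Open Scope ring_scope.

(* A finite bipartite graph G = (A, B, E) is given by two finite types of
   vertices and an edge set E : {set A * B}. *)

Definition is_matching (A B : finType) (M : {set A * B}) : bool :=
  [forall e in M, forall f in M,
    ((e.1 == f.1) || (e.2 == f.2)) ==> (e == f)].

Definition opt (A B : finType) (E : {set A * B}) : {set A * B} :=
  [arg max_(M > set0 | is_matching M && (M \subset E)) #|M|]%N.

Definition greedy_step (A B : finType) (M : {set A * B}) (e : A * B) :
    {set A * B} :=
  if is_matching (e |: M) then e |: M else M.

Definition Greedy (A B : finType) (sigma : seq (A * B)) : {set A * B} :=
  foldl (@greedy_step A B) set0 sigma.

Definition edge_ordering (A B : finType) (E : {set A * B})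
    (pi : seq (A * B)) : Prop :=
  perm_eq pi (enum E).

Definition subseq_in (T : finType) (F : {set T}) (pi : seq T) : seq T :=
  [seq e <- pi | e \in F].

Definition pairs_from (A B : finType) (A' : {set A}) : {set A * B} :=
  setX A' [set: B].

(* The law of the independent random sample A': each a is kept with
   probability p and dropped with probability 1 - p, independently. *)
Definition sample_prob (R : realFieldType) (A : finType) (p : R)
    (A' : {set A}) : R :=
  \prod_(a : A) (if a \in A' then p else 1 - p).

Definition sample_expectation (R : realFieldType) (A : finType) (p : R)
    (X : {set A} -> R) : R :=
  \sum_(A' : {set A}) sample_prob p A' * X A'.

Lemma sample_prob_ge0 (R : realFieldType) (A : finType) (p : R)
    (A' : {set A}) : 0 <= p <= 1 -> 0 <= sample_prob p A'.
Proof.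
move=> /andP[p0 p1]; apply: prodr_ge0 => a _.
by case: ifP; rewrite ?subr_ge0.
Qed.

(* Pr[S \subset A'] = p ^ #|S| for every S: total mass 1 (S = set0),
   Pr[a \in A'] = p (S = [set a]), and mutual independence of the events
   a \in A'. *)
Lemma sample_prob_sub (R : realFieldType) (A : finType) (p : R)
    (S : {set A}) :
  \sum_(A' : {set A} | S \subset A') sample_prob p A' = p ^+ #|S|.
Proof.
pose G (a : A) (b : bool) : R :=
  if b then p else if a \in S then 0 else 1 - p.
transitivity (\sum_(f : {ffun A -> bool}) \prod_a G a (f a)); last first.
  rewrite -bigA_distr_bigA /= -prodr_const [RHS]big_mkcond.
  apply: eq_bigr => a _; rewrite big_bool /G /=.
  by case: ifP => _; rewrite ?addr0 // addrC subrK.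
rewrite (reindex (fun A' : {set A} => [ffun a => a \in A'])) /=; last first.
  exists (fun f : {ffun A -> bool} => [set a | f a]) => [A'|f] _.
    by apply/setP => a; rewrite inE ffunE.
  by apply/ffunP => a; rewrite ffunE inE.
rewrite big_mkcond; apply: eq_bigr => A' _; case: ifP => [sub|/negbT].
  apply: eq_bigr => a _; rewrite ffunE /G; case: ifPn => // aA'.
  by rewrite (contraNF (subsetP sub a) aA').
case/subsetPn => a aS aA'.
by rewrite (bigD1 a) //= ffunE /G (negPf aA') aS mul0r.
Qed.

(* Main.v *)
Require Import Defs.
From HB Require Import structures.
From mathcomp Require Import all_boot all_order all_algebra.
From mathcomp Require Import ring lra.

Set Implicit Arguments.
Unset Strict Implicit.
Unset Printing Implicit Defensive.

Import Order.TTheory GRing.Theory Num.Theory.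
Local Open Scope ring_scope.

(** Let [M S] be the greedy matching obtained from the sample [S]. Enlarging [S]
    can only enlarge the set of matched vertices of [B]. Moreover, if [(a, b)]
    is an edge and [b] is unmatched in [M S] with [a] outside [S], then [a] is
    matched in [M (a |: S)]: otherwise [a] has no influence, so that
    [M (a |: S) = M S], and greedy would have added [(a, b)]. Conditioning on
    the sample outside [a] gives
    [Pr(a is matched) + p * Pr(b is matched) >= p] for every edge [(a, b)], and
    summing over the edges of an optimal matching yields
    [(1 + p) * E|M| >= p * |opt|]. *)

Section GreedyMatching.
Variables A B : finType.
Implicit Types (M : {set A * B}) (e : A * B) (S T : {set A}).
Implicit Types (s : seq (A * B)).

Definition matchedA M : {set A} := [set e.1 | e in M].
Definition matchedB M : {set B} := [set e.2 | e in M].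

Lemma is_matchingP M :
  reflect {in M &, forall e f, e.1 = f.1 \/ e.2 = f.2 -> e = f}
          (is_matching M).
Proof.
apply: (iffP idP) => [/forall_inP h e f eM fM ef|h].
  move/forall_inP: (h e eM) => /(_ f fM) /implyP he; apply/eqP/he.
  by case: ef => ->; rewrite eqxx ?orbT.
apply/forall_inP => e eM; apply/forall_inP => f fM; apply/implyP => ef.
by apply/eqP/h => //; case/orP: ef => /eqP; [left|right].
Qed.

Lemma is_matching_set0 : is_matching (set0 : {set A * B}).
Proof. by apply/is_matchingP => e f; rewrite inE. Qed.

Lemma card_matchedA M : is_matching M -> #|matchedA M| = #|M|.
Proof.
by move/is_matchingP=> mM; apply: card_in_imset => e f eM fM ef; apply: mM; auto.
Qed.

Lemma card_matchedB M : is_matching M -> #|matchedB M| = #|M|.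
Proof.
by move/is_matchingP=> mM; apply: card_in_imset => e f eM fM ef; apply: mM; auto.
Qed.

Lemma matchedAU1 e M : matchedA (e |: M) = e.1 |: matchedA M.
Proof. exact: imsetU1. Qed.

Lemma matchedBU1 e M : matchedB (e |: M) = e.2 |: matchedB M.
Proof. exact: imsetU1. Qed.

Lemma is_matchingU1 e M : is_matching M -> e.1 \notin matchedA M ->
  e.2 \notin matchedB M -> is_matching (e |: M).
Proof.
move/is_matchingP=> mM eA eB; apply/is_matchingP => f g.
have nA h : h \in M -> e.1 <> h.1.
  by move=> hM eh; rewrite eh imset_f in eA.
have nB h : h \in M -> e.2 <> h.2.
  by move=> hM eh; rewrite eh imset_f in eB.
case/setU1P=> [->|fM] /setU1P[->|gM] //; last exact: mM.
  by case=> [/nA|/nB]; case.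
by case=> /esym; [move/nA|move/nB]; case.
Qed.

(** The two tests disagree only when [e] already lies in [M]; then [e |: M] is [M], so the outputs
    still agree. *)
Lemma greedy_stepE M e : is_matching M ->
  greedy_step M e =
    if (e.1 \notin matchedA M) && (e.2 \notin matchedB M) then e |: M else M.
Proof.
move=> mM; rewrite /greedy_step; case: ifP => [meM|nmeM].
  case: ifP => // /negbT; rewrite negb_and !negbK => h.
  suff eM : e \in M by apply/setUidPr; rewrite sub1set.
  by case/orP: h => /imsetP[f fM ef];
     rewrite ((is_matchingP _ meM) e f _ _ _) ?setU11 ?setU1r //; auto.
by case: ifP => // /andP[eA eB]; rewrite is_matchingU1 in nmeM.
Qed.

Lemma is_matching_Greedy s : is_matching (Greedy s).
Proof.
rewrite /Greedy; elim/last_ind: s => [|s e IH]; first exact: is_matching_set0.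
by rewrite foldl_rcons /greedy_step; case: ifP.
Qed.

Definition greedy_sample s S := Greedy (subseq_in (pairs_from B S) s).

Lemma is_matching_greedy_sample s S : is_matching (greedy_sample s S).
Proof. exact: is_matching_Greedy. Qed.

Lemma greedy_sample_rcons s e S :
  greedy_sample (rcons s e) S =
    if [&& e.1 \in S, e.1 \notin matchedA (greedy_sample s S)
         & e.2 \notin matchedB (greedy_sample s S)]
    then e |: greedy_sample s S else greedy_sample s S.
Proof.
rewrite {1}/greedy_sample /Greedy /subseq_in filter_rcons /pairs_from.
rewrite !inE andbT; case: (e.1 \in S) => //=.
by rewrite foldl_rcons greedy_stepE // is_matching_Greedy.
Qed.

(* The second inclusion is what makes the induction for the first go through. *)
Lemma matched_greedy_sampleS s S T : S \subset T ->
  (matchedB (greedy_sample s S) \subset matchedB (greedy_sample s T)) &&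
  (S :&: matchedA (greedy_sample s T) \subset matchedA (greedy_sample s S)).
Proof.
move=> /subsetP ST; elim/last_ind: s => [|s e /andP[/subsetP IB /subsetP IA]].
  by rewrite /greedy_sample /Greedy /= /matchedA /matchedB !imset0 setI0 !sub0set.
rewrite !greedy_sample_rcons.
move: (greedy_sample s S) (greedy_sample s T) IA IB => M N IA IB.
have {}IA x : x \in S -> x \in matchedA N -> x \in matchedA M.
  by move=> xS xN; apply: IA; rewrite inE xS.
apply/andP; split; apply/subsetP => x; last first.
  rewrite inE => /andP[xS] xN.
  have [xM|xM] := boolP (x \in matchedA M).
    by case: ifP => // _; rewrite matchedAU1 setU1r.
  (* Here [x] must be [e.1], newly matched in the run on [T]. As [e.2] is free in [N], it is free in
     [M] by [IB], so the run on [S] accepts [e] as well. *)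
  case: ifP xN => [/and3P[eT eN yN]|_ xN]; last by rewrite IA in xM.
  rewrite matchedAU1 => /setU1P[xe|xN]; last by rewrite IA in xM.
  by rewrite -xe xS xM (contra (IB e.2) yN) /= matchedAU1 xe setU11.
have [xN _|xN] := boolP (x \in matchedB N).
  by case: ifP => // _; rewrite matchedBU1 setU1r.
(* Dually, [x] is [e.2], and [e.1] is free in [N] by the contrapositive of [IA], so the run on [T]
   accepts [e]. *)
case: ifP => [/and3P[eS eM yM]|_ xM]; last by rewrite IB in xN.
rewrite matchedBU1 => /setU1P[xe|xM]; last by rewrite IB in xN.
by rewrite -xe xN ST // (contra (IA e.1 eS) eM) /= matchedBU1 xe setU11.
Qed.

(** The two runs can first diverge only by accepting an edge at [a], and greedy never drops an edge,
    so [a] then stays matched. *)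
Lemma matched_or_greedy_sample_eq s S a :
  a \in matchedA (greedy_sample s (a |: S)) \/
  greedy_sample s (a |: S) = greedy_sample s S.
Proof.
elim/last_ind: s => [|s e IH]; first by right.
rewrite !greedy_sample_rcons !inE; case: IH => [aM|->].
  by left; case: ifP => // _; rewrite matchedAU1 setU1r.
case: eqVneq => [<-|_] /=; last by right.
case: ifP => _; first by left; rewrite matchedAU1 setU11.
by right; rewrite andbF.
Qed.

(** When [e] is processed it is either accepted or blocked by a matched endpoint, and matched
    vertices stay matched. *)
Lemma greedy_sample_maximal s S e : e \in s -> e.1 \in S ->
  e.1 \in matchedA (greedy_sample s S) \/ e.2 \in matchedB (greedy_sample s S).
Proof.
elim/last_ind: s => // s f IH; rewrite mem_rcons inE greedy_sample_rcons.
case/predU1P => [<- -> /=|es eS].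
  case: ifP => [_|/negbT]; first by left; rewrite matchedAU1 setU11.
  by rewrite negb_and !negbK => /orP.
case: ifP => _; last exact: IH.
by rewrite matchedAU1 matchedBU1 !inE; case: (IH es eS) => ->; rewrite orbT; auto.
Qed.

Lemma matched_edge_endpoint s S e : e \in s ->
  e.1 \in matchedA (greedy_sample s (e.1 |: S)) \/
  e.2 \in matchedB (greedy_sample s S).
Proof.
move=> es; case: (matched_or_greedy_sample_eq s S e.1) => [|eqM]; first by left.
by rewrite -eqM; apply: greedy_sample_maximal; rewrite ?setU11.
Qed.

Lemma opt_spec (E : {set A * B}) : is_matching (opt E) && (opt E \subset E).
Proof.
rewrite /opt; case: arg_maxnP => //.
by rewrite is_matching_set0 sub0set.
Qed.

End GreedyMatching.

Section Sampling.
Variables (R : realFieldType) (A : finType) (p : R).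
Implicit Types (X Y : {set A} -> R) (a : A) (S : {set A}).

Lemma sample_expectationZ c X :
  sample_expectation p (fun S => c * X S) = c * sample_expectation p X.
Proof.
by rewrite /sample_expectation mulr_sumr; apply: eq_bigr => S _; rewrite mulrCA.
Qed.

Lemma sample_expectation_sum (I : finType) (P : pred I)
    (X : I -> {set A} -> R) :
  sample_expectation p (fun S => \sum_(i | P i) X i S) =
  \sum_(i | P i) sample_expectation p (X i).
Proof.
by rewrite exchange_big; apply: eq_bigr => S _; rewrite mulr_sumr.
Qed.

Lemma sample_expectation_cst c : sample_expectation p (fun _ : {set A} => c) = c.
Proof.
rewrite /sample_expectation -mulr_suml.
have := sample_prob_sub p (set0 : {set A}); rewrite cards0 expr0.
rewrite (eq_bigl predT) => [->|S]; first by rewrite mul1r.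
by rewrite sub0set.
Qed.

(** Samples are paired as [S] and [a |: S] with [a] outside [S]; the product over [b != a] is the
    law of the rest of the sample. *)
Lemma sample_expectation_split a X :
  sample_expectation p X =
  \sum_(S : {set A} | a \notin S)
    (\prod_(b | b != a) (if b \in S then p else 1 - p)) *
    ((1 - p) * X S + p * X (a |: S)).
Proof.
rewrite /sample_expectation (bigID (fun S : {set A} => a \in S)) /=.
rewrite (reindex_onto (fun S => a |: S) (fun S => S :\ a)) /=; last first.
  by move=> S aS; rewrite setD1K.
rewrite (eq_bigl (fun S : {set A} => a \notin S)) => [|S]; last first.
  rewrite setU11 /=; apply/eqP/idP => [<-|aS]; first by rewrite setD11.
  by rewrite setU1K.
rewrite -big_split; apply: eq_bigr => S aS /=.
rewrite /sample_prob (bigD1 a) //= setU11 (bigD1 a (P := predT)) //= (negPf aS).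
rewrite (eq_bigr (fun b => if b \in S then p else 1 - p)) => [|b ba].
  by ring.
by rewrite !inE (negPf ba).
Qed.

Hypothesis hp : 0 <= p <= 1.

Lemma le_sample_expectation X Y : (forall S, X S <= Y S) ->
  sample_expectation p X <= sample_expectation p Y.
Proof.
by move=> XY; apply: ler_sum => S _; rewrite ler_wpM2l // sample_prob_ge0.
Qed.

Lemma sample_expectation_ge_cond a c X :
  (forall S, a \notin S -> c <= (1 - p) * X S + p * X (a |: S)) ->
  c <= sample_expectation p X.
Proof.
(* Writing [c] as an expectation and splitting it too allows a comparison term by term in [S]. *)
move=> cX; rewrite -{1}(sample_expectation_cst c) !(sample_expectation_split a).
apply: ler_sum => S aS; apply: ler_wpM2l; last first.
  by rewrite -mulrDl subrK mul1r; apply: cX.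
by case/andP: hp => p0 p1; apply: prodr_ge0 => b _; case: ifP; rewrite ?subr_ge0.
Qed.

End Sampling.

(** The sum counts the points of the image of [O] that lie in [V]. It serves with [O] the optimal
    matching and [f] an endpoint map. *)
Lemma sum_mem_injective_le (R : numDomainType) (T U : finType) (O : {set T})
    (f : T -> U) (V : {set U}) : {in O &, injective f} ->
  \sum_(x in O) (f x \in V)%:R <= #|V|%:R :> R.
Proof.
move=> injf; rewrite -natr_sum ler_nat.
rewrite -(big_imset (fun y => (y \in V) : nat) injf) -sum1_card /=.
rewrite -big_mkcondr sum1_card sum1_card.
by apply/subset_leq_card/subsetP => y /andP[].
Qed.

Lemma edge_matched_expectation (R : realFieldType) (p : R) (A B : finType)
    (s : seq (A * B)) (e : A * B) : 0 <= p <= 1 -> e \in s ->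
  p <= sample_expectation p (fun S =>
         (e.1 \in matchedA (greedy_sample s S))%:R
         + p * (e.2 \in matchedB (greedy_sample s S))%:R).
Proof.
move=> hp es; apply: (@sample_expectation_ge_cond _ _ _ hp e.1) => S _.
have /andP[/subsetP/(_ e.2) mono _] := matched_greedy_sampleS s (subsetU1 e.1 S).
have /andP[p0 p1] := hp.
(* If [e.2] is matched without [e.1] in the sample, it is by [mono] also matched with it, and its
   term gives [(1 - p) * p + p * p = p]. Otherwise [e.1] is matched once sampled, which alone
   contributes [p]. *)
have [yS|yS] := boolP (e.2 \in matchedB (greedy_sample s S)).
  rewrite (mono yS); do 2!case: (_ \in _) => /=; nra.
case: (matched_edge_endpoint S es) => [->|]; last by rewrite (negPf yS).
by do 2!case: (_ \in _) => /=; nra.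
Qed.

Theorem theorem2 (R : realFieldType) (p : R) (hp0 : 0 < p) (hp1 : p <= 1)
    (A B : finType) (E : {set A * B}) (pi : seq (A * B))
    (hpi : edge_ordering E pi) :
  p / (1 + p) * #|opt E|%:R <=
    sample_expectation p
      (fun A' : {set A} => #|Greedy (subseq_in (pairs_from B A') pi)|%:R).
Proof.
have hp : 0 <= p <= 1 by rewrite ltW.
have /andP[/is_matchingP mO /subsetP OE] := opt_spec E.
(* Clearing the denominator leaves [p * #|opt E|], a sum of one [p] per optimal edge, to be bounded
   edge by edge. *)
rewrite mulrAC ler_pdivrMr; last by lra.
rewrite [leRHS]mulrC -sample_expectationZ.
rewrite mulr_natr -sumr_const.
apply: (@le_trans _ _ (\sum_(e in opt E) sample_expectation p (fun S =>
         (e.1 \in matchedA (greedy_sample pi S))%:R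
         + p * (e.2 \in matchedB (greedy_sample pi S))%:R))).
  apply: ler_sum => e eO; apply: edge_matched_expectation => //.
  by rewrite (perm_mem hpi) mem_enum OE.
rewrite -sample_expectation_sum; apply: le_sample_expectation => // S.
(* For fixed [S], a greedy matching [M] covers exactly [#|M|] vertices on each side: the first
   endpoints account for [#|M|] and the second for [p * #|M|]. *)
rewrite big_split /= -mulr_sumr mulrDl mul1r.
have mM := is_matching_greedy_sample pi S.
apply: lerD; last (apply: ler_wpM2l; first exact: ltW).
- rewrite -/(greedy_sample pi S) -(card_matchedA mM).
  by apply: sum_mem_injective_le => e f eO fO ef; apply: mO; auto.
- rewrite -/(greedy_sample pi S) -(card_matchedB mM).
  by apply: sum_mem_injective_le => e f eO fO ef; apply: mO; auto.
Qed.
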